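(* A discrete subset $D$ of $\mathbb{C}^n$ is tame (in the sense defined in the context) if and only if it is tame in the sense of Rosay and Rudin, i.e., if and only if there exists a holomorphic automorphism $\phi$ of $\mathbb{C}^n$ such that $\phi(D)=\mathbb{Z}\times\{0\}^{n-1}$.
   Context: A discrete subset of a complex manifold $X$ is a subset without accumulation points in $X$. An automorphism of $X$ is a biholomorphic self-map of $X$. An exhaustion function on $X$ is a continuous function $\rho:X\to\mathbb{R}^+$ all of whose sublevel sets $\{x\in X:\rho(x)\le c\}$ are compact. An infinite discrete subset $D\subset X$ is called tame if for every exhaustion function $\rho:X\to\mathbb{R}^+$ and every map $\zeta:D\to\mathbb{R}^+$ there exists an automorphism $\phi$ of $X$ such that $\rho(\phi(x))\ge\zeta(x)$ for all $x\in D$.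
   Formalization: The formal theorem assumes n ≥ 2; for n = 1 the claim fails (D = Z is mapped to Z by the identity, but automorphisms of C are affine, so Z is not tame), and for n = 0 the set Z×{0}^{n-1} is undefined. *)

(* Defs.v *)
From HB Require Import structures.
From mathcomp Require Import all_boot all_order all_algebra.
From mathcomp Require Import complex.
From mathcomp Require Import all_classical all_reals all_analysis.
Set Implicit Arguments.
Unset Strict Implicit.
Unset Printing Implicit Defensive.
Import Order.TTheory GRing.Theory Num.Theory.
Import numFieldNormedType.Exports.

Local Open Scope classical_set_scope.
Local Open Scope ring_scope.
Local Open Scope complex_scope.

(* R[i] itself has no topological instances; packing it as a
   numClosedFieldType makes the generic ones (topology of the modulus) apply to
   Cplx R and to 'rV[Cplx R]_n. *)
Definition Cplx (R : realType) : numClosedFieldType := R[i].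

Section ComplexSpace.
Variables (R : realType) (n : nat).
Local Notation Cn := 'rV[Cplx R]_n.

Definition discrete_subset (D : set Cn) : Prop := limit_point D = set0.

(* The differential is linear over Cplx R, so this is holomorphy on C^n. *)
Definition holomorphic (f : Cn -> Cn) : Prop :=
  forall z, differentiable f z.

Definition automorphism (phi : Cn -> Cn) : Prop :=
  exists psi : Cn -> Cn,
    [/\ cancel phi psi, cancel psi phi, holomorphic phi & holomorphic psi].

Definition exhaustion_function (rho : Cn -> R) : Prop :=
  [/\ forall z, 0 <= rho z,
      continuous rho
    & forall c : R, compact [set z | rho z <= c]].

(* A map zeta : D -> R^+ is represented by a function on C^n of which only the
   values on D matter. *)
Definition tame (D : set Cn) : Prop :=
  [/\ infinite_set D,
      discrete_subset D
    & forall (rho zeta : Cn -> R),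
        exhaustion_function rho ->
        (forall x, D x -> 0 <= zeta x) ->
        exists2 phi : Cn -> Cn, automorphism phi &
          forall x, D x -> rho (phi x) >= zeta x].

(* Z x {0}^(n-1) *)
Definition first_axis_integers : set Cn :=
  [set z | exists k : int,
    z = \row_(j < n) (if j == 0%N :> nat then k%:~R else 0)].

Definition rosay_rudin_tame (D : set Cn) : Prop :=
  exists2 phi : Cn -> Cn, automorphism phi & phi @` D = first_axis_integers.

End ComplexSpace.

(* Main.v *)
Require Import Defs.
From mathcomp Require Import all_boot all_order all_algebra.
From mathcomp Require Import all_classical all_reals all_analysis.
From mathcomp Require Import complex ring lra.

Set Implicit Arguments.
Unset Strict Implicit.
Unset Printing Implicit Defensive.
Import Order.TTheory GRing.Theory Num.Theory.
Import numFieldNormedType.Exports.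
Local Open Scope classical_set_scope.
Local Open Scope ring_scope.

(** Both directions rest on interpolation by entire functions: if [b k] are
    distinct with [k < |b k|], an entire function takes arbitrary prescribed values
    at the [b k] ([entire_interpolation]). It turns into automorphisms of C^n
    through shears [z |-> z + h (l z)], where [l] is a linear form that kills the
    values of [h] ([automorphism_shear]).

    If an automorphism maps [D] onto the integers of the first axis, compose it
    with a shear along the second axis by an entire function of the first
    coordinate. The shear can move each integer, along the line through it parallel
    to the second axis, to any point; some point lies outside the sublevel set to
    be avoided, because a compact set contains no line
    ([tame_of_rosay_rudin_tame]).

    Conversely, take the l1 norm as exhaustion function and enumerate [D], which
    is countable because it is discrete. Were there a linear form [l] that tends to
    infinity along [D] and separates its points, shears would move [D] onto the
    integers of the first axis ([straighten_escaping_sequence]). A form of this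
    kind need not exist for [D] itself, but it does for its image under an
    automorphism that pushes the points far enough. For any sequence of vectors
    [y k] one can choose [l] with [|l (y k)| >= eps k * |y k|], where [eps] is
    fixed in advance ([exists_generic_form]): the coefficients of [l] are found by
    successive corrections whose sizes decrease geometrically. Tameness gives an
    automorphism after which the [k]-th point has norm at least [(k + 1) / eps k],
    hence [l] is larger than [k] there; feeding the pairwise differences of the
    points to the same construction makes [l] injective on them
    ([rosay_rudin_tame_of_tame]). *)

(** * Modulus and squeezed limits *)

Section Modulus.
Variable R : realType.
Implicit Types (x y z : Cplx R) (a b : R).

(** The norm of [Cplx R] is a complex number with zero imaginary part; the
    estimates below take place in [R], where the order is total. *)
Definition modulus z : R := complex.Re `|z|.

Lemma normE z : `|z| = (modulus z)%:C%C.
Proof. by rewrite /modulus [X in _ = (complex.Re X)%:C%C]normc_def normc_def. Qed.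

Lemma modulus_normc z : modulus z = Normc.normc z.
Proof. by case: z. Qed.

Lemma modulus_ge0 z : 0 <= modulus z.
Proof. by rewrite -lecR -normE normr_ge0. Qed.

Lemma modulusD x y : modulus (x + y) <= modulus x + modulus y.
Proof. by rewrite -lecR rmorphD /= -!normE ler_normD. Qed.

Lemma modulusM x y : modulus (x * y) = modulus x * modulus y.
Proof. by rewrite !modulus_normc Normc.normcM. Qed.

Lemma modulusN x : modulus (- x) = modulus x.
Proof. by rewrite /modulus normrN. Qed.

Lemma modulusB x y : modulus (x - y) = modulus (y - x).
Proof. by rewrite /modulus distrC. Qed.

Lemma modulus0 : modulus 0 = 0.
Proof. by rewrite /modulus normr0. Qed.

Lemma modulus1 : modulus 1 = 1.
Proof. by rewrite /modulus normr1. Qed.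

Lemma modulusV x : modulus x^-1 = (modulus x)^-1.
Proof. by rewrite !modulus_normc Normc.normcV. Qed.

Lemma modulusX x k : modulus (x ^+ k) = modulus x ^+ k.
Proof. by elim: k => [|k IH]; rewrite ?modulus1 // !exprS modulusM IH. Qed.

Lemma modulus_eq0 x : modulus x = 0 -> x = 0.
Proof. by move=> h; apply/eqP; rewrite -normr_eq0 normE h. Qed.

Lemma modulus_gt0 x : x != 0 -> 0 < modulus x.
Proof.
move=> x0; rewrite lt_def modulus_ge0 andbT.
by apply: contra x0 => /eqP /modulus_eq0 ->.
Qed.

Lemma modulus_sum (I : Type) (r : seq I) (P : pred I) (F : I -> Cplx R) :
  modulus (\sum_(i <- r | P i) F i) <= \sum_(i <- r | P i) modulus (F i).
Proof.
elim/big_rec2: _ => [|i b z _ h]; first by rewrite modulus0.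
by apply: le_trans (modulusD _ _) _; rewrite lerD2l.
Qed.

Lemma modulus_real a : modulus (a%:C%C : Cplx R) = `|a|.
Proof. by rewrite modulus_normc /= expr0n addr0 sqrtr_sqr. Qed.

Lemma Re_le_modulus z : `|complex.Re z| <= modulus z.
Proof. by rewrite -lecR -normE normc_ge_Re. Qed.

Lemma Im_le_modulus z : `|complex.Im z| <= modulus z.
Proof.
case: z => a b; rewrite modulus_normc /= -sqrtr_sqr.
by apply: ler_wsqrtr; rewrite lerDr sqr_ge0.
Qed.

Lemma modulus_le_ReIm z : modulus z <= `|complex.Re z| + `|complex.Im z|.
Proof.
case: z => a b; rewrite modulus_normc /=.
have ab0 : 0 <= `|a| + `|b| by rewrite addr_ge0.
rewrite -(ger0_norm ab0) -[leRHS]sqrtr_sqr; apply: ler_wsqrtr.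
by rewrite sqrrD !real_normK ?num_real // lerD2r lerDl mulrn_wge0 // mulr_ge0.
Qed.

(** Completeness of [R] in the form that serves every limit of the development.
    The hypothesis makes the intervals [S m - e m, S m + e m] nested, so the
    supremum of the left endpoints lies in all of them; the rate of convergence
    comes with the limit. *)
Lemma squeeze_limit (S e : nat -> R) :
  (forall m, 0 <= e m) -> (forall m, `|S m.+1 - S m| <= e m - e m.+1) ->
  exists s, forall m, `|s - S m| <= e m.
Proof.
move=> e0 hS.
have lo m k : S m - e m <= S (m + k)%N - e (m + k)%N.
  elim: k => [|k IH]; first by rewrite addn0.
  apply: le_trans IH _; rewrite addnS; have := hS (m + k)%N; rewrite ler_norml; lra.
have up m k : S (m + k)%N + e (m + k)%N <= S m + e m.
  elim: k => [|k IH]; first by rewrite addn0.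
  apply: le_trans IH; rewrite addnS; have := hS (m + k)%N; rewrite ler_norml; lra.
have lu m k : S m - e m <= S k + e k.
  have h1 := lo m k; have h2 := up k m; have h3 := e0 (m + k)%N.
  rewrite addnC in h2; lra.
pose A := [set S m - e m | m in [set: nat]].
have A0 : A !=set0 by exists (S 0 - e 0); exists 0%N.
have Aub : has_ubound A by exists (S 0 + e 0) => _ [m _ <-].
exists (sup A) => m.
have h1 : S m - e m <= sup A by apply: sup_upper_bound => //; exists m.
have h2 : sup A <= S m + e m by apply: ge_sup => // _ [k _ <-].
by rewrite ler_norml; lra.
Qed.

Lemma squeeze_limit_complex (S : nat -> Cplx R) (e : nat -> R) :
  (forall m, 0 <= e m) -> (forall m, modulus (S m.+1 - S m) <= e m - e m.+1) ->
  exists s, forall m, modulus (s - S m) <= 2 * e m.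
Proof.
move=> e0 hS.
have [|a ha] := @squeeze_limit (fun m => complex.Re (S m)) e e0.
  by move=> m; apply: le_trans (hS m); rewrite -raddfB; exact: Re_le_modulus.
have [|b hb] := @squeeze_limit (fun m => complex.Im (S m)) e e0.
  by move=> m; apply: le_trans (hS m); rewrite -raddfB; exact: Im_le_modulus.
exists (a +i* b)%C => m; apply: le_trans (modulus_le_ReIm _) _.
by rewrite !raddfB /=; have := ha m; have := hb m; lra.
Qed.

End Modulus.

(** * Entire functions as series of polynomials *)

Section EntireSeries.
Variable R : realType.
Implicit Types (z u : Cplx R) (p : {poly Cplx R}) (rho : R).

Lemma le_of_geometric_error (x a K : R) :
  (forall m, x <= a + K / 2 ^+ m) -> x <= a.
Proof.
move=> h; apply/ler_addgt0Pr => e e0.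
have [m hm] : exists m, K / 2 ^+ m <= e.
  exists (Num.truncn (K / e)).+1.
  rewrite ler_pdivrMr ?exprn_gt0 // -ler_pdivrMl // mulrC.
  apply: le_trans (ltW (truncnS_gt _)) _.
  by rewrite -natrX ler_nat ltnW // ltn_expl.
by apply: le_trans (h m) _; rewrite lerD2l.
Qed.

(** A remainder that is quadratic in [u] makes the difference quotient converge
    at linear speed; this form of the derivative survives summation because the
    constants [K] of the terms can be added. *)
Lemma differentiable_of_quadratic (h : Cplx R -> Cplx R) (z d : Cplx R) (K : R) :
  (forall u, modulus u <= 1 ->
     modulus (h (z + u) - h z - u * d) <= K * modulus u ^+ 2) ->
  differentiable h z.
Proof.
move=> hK; apply/derivable1_diffP/cvg_ex; exists d.
apply/cvgrPdist_le => e e0.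
have K0 : 0 <= K.
  have := hK 1; rewrite modulus1 expr1n mulr1 => /(_ (lexx _)).
  exact/le_trans/modulus_ge0.
have er : (complex.Re e)%:C%C = e by rewrite RRe_real // gtr0_real.
have e0' : 0 < complex.Re e by rewrite -ltcR er.
near=> u.
have u0 : u != 0 by near: u; exact: nbhs_dnbhs_neq.
have : `|u| < ((Num.min 1 (complex.Re e / (K + 1)))%:C)%C.
  near: u; apply: dnbhs0_lt; rewrite ltcR lt_min ltr01 divr_gt0 //; lra.
rewrite normE ltcR lt_min => /andP[u1 ue].
rewrite -er normE lecR /=.
have -> : d - u^-1 *: (h (u *: 1 + z) - h z) = - (u^-1 * (h (z + u) - h z - u * d)).
  rewrite [in LHS]/GRing.scale /= mulr1 [u + z]addrC.
  by rewrite [in RHS]mulrBr [_ * (u * d)]mulrA mulVf // mul1r opprB.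
rewrite modulusN modulusM modulusV ler_pdivrMl ?modulus_gt0 //.
apply: le_trans (hK _ (ltW u1)) _.
rewrite expr2 mulrA mulrC ler_wpM2l ?modulus_ge0 //.
move: ue; rewrite ltr_pdivlMr; last by lra.
move=> /ltW; apply: le_trans; rewrite mulrC ler_wpM2l ?modulus_ge0 //; lra.
Unshelve. all: by end_near.
Qed.

(** The sum of the majorant series at radius [rho]: it bounds the polynomial on
    the disc of radius [rho] and, up to a power of the radius, its derivative and
    its second order remainder on the disc of half that radius, a role that
    Cauchy's estimates play for general holomorphic functions. *)
Definition coef_norm p rho : R := \sum_(i < size p) modulus p`_i * rho ^+ i.

Lemma coef_norm_ge0 p rho : 0 <= rho -> 0 <= coef_norm p rho.
Proof.
by move=> r0; apply: sumr_ge0 => i _; rewrite mulr_ge0 ?modulus_ge0 ?exprn_ge0.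
Qed.

Lemma ler_coef_norm p rho rho' :
  0 <= rho -> rho <= rho' -> coef_norm p rho <= coef_norm p rho'.
Proof.
move=> r0 rr; apply: ler_sum => i _.
by rewrite ler_wpM2l ?modulus_ge0 // lerXn2r // nnegrE ?(le_trans r0).
Qed.

Lemma modulus_horner p z rho : modulus z <= rho ->
  modulus p.[z] <= coef_norm p rho.
Proof.
move=> zr; rewrite horner_coef; apply: le_trans (modulus_sum _ _ _) _.
apply: ler_sum => i _; rewrite modulusM modulusX ler_wpM2l ?modulus_ge0 //.
by rewrite lerXn2r ?nnegrE ?modulus_ge0 ?(le_trans (modulus_ge0 z)).
Qed.

Lemma horner_deriv p z : p^`().[z] = \sum_(i < size p) p`_i * (z ^+ i.-1 *+ i).
Proof.
rewrite -[p in LHS]coefK poly_def raddf_sum /= horner_sum.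
by apply: eq_bigr => i _; rewrite derivZ derivXn hornerZ hornerMn hornerXn.
Qed.

Lemma modulusMn z m : modulus (z *+ m) = modulus z *+ m.
Proof.
have mE : (m%:R : Cplx R) = (m%:R : R)%:C%C by rewrite rmorph_nat.
by rewrite -mulr_natl modulusM mE modulus_real normr_nat mulr_natl.
Qed.

Lemma modulus_horner_deriv p z rho : 0 < rho -> modulus z <= rho ->
  modulus p^`().[z] * rho <= coef_norm p (2 * rho).
Proof.
move=> r0 zr; rewrite horner_deriv.
apply: le_trans (ler_wpM2r (ltW r0) (modulus_sum _ _ _)) _.
rewrite mulr_suml; apply: ler_sum => -[[|i] /= _] _.
  by rewrite mulr0n mulr0 modulus0 mul0r mulr1 modulus_ge0.
rewrite modulusM -mulrA ler_wpM2l ?modulus_ge0 //.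
rewrite modulusMn modulusX -(mulr_natl (_ ^+ i)) exprMn [in leRHS](exprSr rho) [in leRHS]mulrA.
rewrite ler_wpM2r ?(ltW r0) // ler_pM ?ler0n ?exprn_ge0 ?modulus_ge0 //.
  by rewrite -natrX ler_nat ltnW // ltn_expl.
by rewrite lerXn2r // nnegrE ?modulus_ge0 // ltW.
Qed.

(** The factor [2 ^+ i - i%:R - 1] is the number of terms of degree at least two
    in [u] in the binomial expansion of [(z + u) ^+ i], counted with
    multiplicity. *)
Lemma exprD_quadratic z u rho i : modulus z <= rho -> modulus u <= rho ->
  modulus ((z + u) ^+ i - z ^+ i - u * (z ^+ i.-1 *+ i)) * rho ^+ 2
    <= (2 ^+ i - i%:R - 1) * rho ^+ i * modulus u ^+ 2.
Proof.
move=> zr ur; have r0 : 0 <= rho := le_trans (modulus_ge0 z) zr.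
elim: i => [|i IH].
  by rewrite !expr0 mulr0n mulr0 !(subr0, subrr) modulus0 !mul0r.
have -> : (z + u) ^+ i.+1 - z ^+ i.+1 - u * (z ^+ i.+1.-1 *+ i.+1) =
    (z + u) * ((z + u) ^+ i - z ^+ i - u * (z ^+ i.-1 *+ i)) +
    u ^+ 2 * (z ^+ i.-1 *+ i).
  have -> : z ^+ i.+1.-1 *+ i.+1 = z ^+ i + z * (z ^+ i.-1 *+ i).
    by case: (i) => [|j] /=; rewrite ?mulr0n ?mulr0 ?addr0 // mulrnAr -exprS -mulrS.
  by rewrite !exprS /=; ring.
apply: le_trans (ler_wpM2r (sqr_ge0 _) (modulusD _ _)) _.
rewrite mulrDl (modulusM (z + u)) (modulusM (u ^+ 2)) modulusX -[X in X + _]mulrA.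
have h1 : modulus (z + u) <= 2 * rho.
  by apply: le_trans (modulusD _ _) _; lra.
have h2 := ler_pM (modulus_ge0 _) (mulr_ge0 (modulus_ge0 _) (sqr_ge0 _)) h1 IH.
apply: le_trans (lerD h2 (lexx _)) _.
have h3 : modulus (z ^+ i.-1 *+ i) * rho ^+ 2 <= i%:R * rho ^+ i.+1.
  case: (i) => [|j]; first by rewrite mulr0n modulus0 !mul0r.
  rewrite modulusMn modulusX -(mulr_natl (_ ^+ j)) -mulrA ler_wpM2l //= -[j.+2]addn2 exprD.
  by rewrite ler_wpM2r ?sqr_ge0 // lerXn2r ?nnegrE ?modulus_ge0.
set a := modulus u; have a0 : 0 <= a ^+ 2 by exact: sqr_ge0.
have h4 := ler_wpM2l a0 h3.
rewrite -[X in _ + X <= _]mulrA; apply: le_trans (lerD (lexx _) h4) _.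
by rewrite le_eqVlt; apply/orP; left; apply/eqP; rewrite -natr1 !exprS; ring.
Qed.

Lemma horner_quadratic p z u rho : modulus z <= rho -> modulus u <= rho ->
  modulus (p.[z + u] - p.[z] - u * p^`().[z]) * rho ^+ 2
    <= coef_norm p (2 * rho) * modulus u ^+ 2.
Proof.
move=> zr ur; have r0 : 0 <= rho := le_trans (modulus_ge0 z) zr.
have -> : p.[z + u] - p.[z] - u * p^`().[z] = \sum_(i < size p)
    p`_i * ((z + u) ^+ i - z ^+ i - u * (z ^+ i.-1 *+ i)).
  rewrite horner_deriv !horner_coef mulr_sumr -!sumrB.
  by apply: eq_bigr => i _; ring.
apply: le_trans (ler_wpM2r (sqr_ge0 _) (modulus_sum _ _ _)) _.
rewrite /coef_norm !mulr_suml; apply: ler_sum => i _.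
rewrite modulusM -!mulrA ler_wpM2l ?modulus_ge0 //.
apply: le_trans (exprD_quadratic i zr ur) _.
rewrite ler_wpM2r ?sqr_ge0 // exprMn ler_wpM2r ?exprn_ge0 //.
by have : 0 <= i%:R :> R by []; lra.
Qed.

(** Weierstrass' theorem for series of polynomials. The geometric bounds make
    the values, the derivatives and the quadratic remainders summable on every
    disc, so the sum is differentiable term by term. *)
Lemma entire_series (p : nat -> {poly Cplx R}) :
  (forall rho, 0 < rho ->
     exists M, forall k, coef_norm (p k) rho <= M / 2 ^+ k) ->
  exists h : Cplx R -> Cplx R, (forall z, differentiable h z) /\
    forall z, exists M,
      forall m, modulus (h z - \sum_(k < m) (p k).[z]) <= M / 2 ^+ m.
Proof.
move=> hp.
(* At each point, limits of the series of values and of derivatives. *)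
have sum_ex (a : nat -> Cplx R) (M : R) :
    (forall k, modulus (a k) <= M / 2 ^+ k) ->
    exists s, forall m, modulus (s - \sum_(k < m) a k) <= 4 * M / 2 ^+ m.
  move=> ha.
  have M0 : 0 <= M.
    by have := le_trans (modulus_ge0 _) (ha 0); rewrite expr0 divr1.
  have [||s hs] := @squeeze_limit_complex R (fun m => \sum_(k < m) a k)
    (fun m => 2 * M / 2 ^+ m).
  - by move=> m; rewrite divr_ge0 ?exprn_ge0 // mulr_ge0.
  - move=> m; rewrite big_ord_recr /= [X in modulus X]addrC addKr.
    apply: le_trans (ha m) _; rewrite exprS le_eqVlt; apply/orP; left; apply/eqP.
    by field; rewrite expf_neq0 // pnatr_eq0.
  by exists s => m; apply: le_trans (hs m) _; rewrite !mulrA -natrM.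
have /choice[h hh] z : exists s, exists M,
    forall m, modulus (s - \sum_(k < m) (p k).[z]) <= M / 2 ^+ m.
  have r0 : 0 < modulus z + 1 by rewrite ltr_wpDl ?modulus_ge0.
  have [M hM] := hp _ r0.
  have [|s hs] := sum_ex (fun k => (p k).[z]) M.
    by move=> k; apply: le_trans (hM k); apply: modulus_horner; rewrite lerDl.
  by exists s, (4 * M).
exists h; split=> // z.
set rho := modulus z + 1.
have r1 : 1 <= rho by rewrite lerDr modulus_ge0.
have zr : modulus z <= rho by rewrite lerDl.
have r0 : 0 < 2 * rho by lra.
have [M hM] := hp _ r0.
have M0 : 0 <= M.
  by have := le_trans (coef_norm_ge0 _ (ltW r0)) (hM 0); rewrite expr0 divr1.
have [|d hd] := sum_ex (fun k => (p k)^`().[z]) M.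
  move=> k; apply: le_trans (hM k).
  have := @modulus_horner_deriv (p k) z rho _ zr; rewrite (lt_le_trans ltr01) //.
  by move=> /(_ isT); apply: le_trans; rewrite ler_peMr ?modulus_ge0.
apply: (@differentiable_of_quadratic h z d (2 * M)) => u u1.
have [M1 h1] := hh z; have [M2 h2] := hh (z + u).
(* Compare with the [m]-th partial sum; the three errors are [O(2 ^- m)]. *)
apply: (@le_of_geometric_error _ _ (M1 + M2 + 4 * M)) => m.
set S1 := \sum_(k < m) (p k).[z] in h1 *.
pose E := \sum_(k < m) ((p k).[z + u] - (p k).[z] - u * (p k)^`().[z]).
have -> : h (z + u) - h z - u * d = E + (h (z + u) - \sum_(k < m) (p k).[z + u])
    - (h z - \sum_(k < m) (p k).[z]) - u * (d - \sum_(k < m) (p k)^`().[z]).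
  by rewrite /E !sumrB -mulr_sumr; ring.
have hE : modulus E <= 2 * M * modulus u ^+ 2.
  apply: le_trans (modulus_sum _ _ _) _.
  apply: (@le_trans _ _ (\sum_(k < m) modulus u ^+ 2 * (M / 2 ^+ k))).
    apply: ler_sum => k _; rewrite [leRHS]mulrC.
    apply: le_trans (ler_wpM2r (sqr_ge0 _) (hM k)).
    apply: le_trans (horner_quadratic (p k) zr (le_trans u1 r1)).
    by rewrite ler_peMr ?modulus_ge0 // exprn_ege1.
  rewrite -mulr_sumr [leLHS]mulrC ler_wpM2r ?sqr_ge0 //.
  have : \sum_(k < m) M / 2 ^+ k = 2 * M - 2 * M / 2 ^+ m.
    elim: (m) => [|j IH]; first by rewrite big_ord0 expr0 divr1 subrr.
    rewrite big_ord_recr /= IH exprS.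
    by field; rewrite expf_neq0 // pnatr_eq0.
  have : 0 <= 2 * M / 2 ^+ m by rewrite divr_ge0 ?exprn_ge0 // mulr_ge0.
  lra.
apply: le_trans (modulusD _ _) _; rewrite modulusN modulusM.
have h3 : modulus u * modulus (d - \sum_(k < m) (p k)^`().[z]) <= 4 * M / 2 ^+ m.
  by apply: le_trans (hd m); rewrite ler_piMl ?modulus_ge0.
have -> : (M1 + M2 + 4 * M) / 2 ^+ m = M1 / 2 ^+ m + M2 / 2 ^+ m + 4 * M / 2 ^+ m.
  by rewrite !mulrDl.
rewrite [leRHS]addrA; apply: lerD h3.
apply: le_trans (modulusD _ _) _; rewrite modulusN.
have := modulusD E (h (z + u) - \sum_(k < m) (p k).[z + u]).
by have := h1 m; have := h2 m; rewrite /S1; lra.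
Qed.

Lemma coef_normZ p (c : Cplx R) rho :
  coef_norm (c *: p) rho = modulus c * coef_norm p rho.
Proof.
have [->|c0] := eqVneq c 0.
  by rewrite scale0r modulus0 mul0r /coef_norm size_poly0 big_ord0.
rewrite /coef_norm size_scale // mulr_sumr; apply: eq_bigr => i _.
by rewrite coefZ modulusM mulrA.
Qed.

Lemma coef_normMXn p N rho :
  coef_norm (p * 'X^N) rho = coef_norm p rho * rho ^+ N.
Proof.
have [->|p0] := eqVneq p 0.
  by rewrite mul0r /coef_norm size_poly0 !big_ord0 mul0r.
rewrite /coef_norm size_mulXn // mulr_suml.
rewrite big_split_ord /= big1 ?add0r; last first.
  by move=> i _; rewrite coefMXn ltn_ord modulus0 mul0r.
apply: eq_bigr => i _; rewrite coefMXn ltnNge leq_addr /= addKn exprD; ring.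
Qed.

End EntireSeries.

(** * Interpolation by entire functions *)

Section Interpolation.
Variable R : realType.

Lemma geometric_small (K q e : R) : 0 <= q < 1 -> 0 < e ->
  exists N, K * q ^+ N <= e.
Proof.
move=> /andP[q0 q1] e0.
have e1 : 0 < e / (`|K| + 1) by rewrite divr_gt0 // ltr_wpDl.
have q1' : `|q| < 1 by rewrite ger0_norm.
have /cvgr0Pnorm_le/(_ _ e1)[N _ hN] := cvg_expr q1'.
exists N; have := hN N (leqnn N); rewrite /= ger0_norm ?exprn_ge0 //.
rewrite ler_pdivlMr ?ltr_wpDl //; apply: le_trans.
rewrite mulrC ler_wpM2l ?exprn_ge0 //; have := ler_norm K; lra.
Qed.

(** Newton interpolation with damping. The [k]-th term is a multiple of
    [(z - b 0) ... (z - b k.-1) * (z / b k) ^+ N]: it leaves the values at the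
    earlier nodes alone and corrects the value at [b k]. Since [k < |b k|], a
    large [N] makes it at most [2 ^- k] on the disc of radius [k], so the series
    is entire. *)
Lemma entire_interpolation (b v : nat -> Cplx R) :
  injective b -> (forall k, k%:R < modulus (b k)) ->
  exists h : Cplx R -> Cplx R,
    (forall z, differentiable h z) /\ forall k, h (b k) = v k.
Proof.
move=> b_inj b_gt.
pose P k : {poly Cplx R} := \prod_(j < k) ('X - (b j)%:P).
(* [T (k, S)] is the term to add to the partial sum [S]. *)
have /choice[T hT] (kS : nat * {poly Cplx R}) : exists t : {poly Cplx R},
    [/\ coef_norm t kS.1%:R <= 1 / 2 ^+ kS.1,
        forall j, (j < kS.1)%N -> t.[b j] = 0
      & (kS.2 + t).[b kS.1] = v kS.1].
  case: kS => k S /=.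
  have bk : 0 < modulus (b k) by apply: le_lt_trans (b_gt k).
  have bk0 : b k != 0.
    by apply/eqP => bE; rewrite bE modulus0 ltxx in bk.
  have Pk0 : (P k).[b k] != 0.
    rewrite horner_prod; apply/prodf_neq0 => j _.
    rewrite hornerXsubC subr_eq0; apply/eqP => /b_inj kj.
    by have := ltn_ord j; rewrite -kj ltnn.
  (* [c *: P k] is the Newton correction of [S], without damping. *)
  pose c := (v k - S.[b k]) / (P k).[b k].
  have [||N hN] := @geometric_small (modulus c * coef_norm (P k) k%:R)
      (k%:R / modulus (b k)) (1 / 2 ^+ k).
  - by rewrite divr_ge0 ?ler0n ?modulus_ge0 //= ltr_pdivrMr // mul1r.
  - by rewrite divr_gt0 ?exprn_gt0.
  exists ((c / b k ^+ N) *: (P k * 'X^N)); split.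
  - rewrite coef_normZ coef_normMXn modulusM modulusV modulusX.
    by apply: le_trans hN; rewrite exprMn exprVn le_eqVlt; apply/orP; left; apply/eqP; ring.
  - move=> j jk; rewrite hornerZ hornerM horner_prod (bigD1 (Ordinal jk)) //=.
    by rewrite hornerXsubC subrr !mul0r mulr0.
  - rewrite hornerD hornerZ hornerM hornerXn /c.
    by field; rewrite Pk0 expf_neq0.
pose S := fix S k := if k is k'.+1 then S k' + T (k', S k') else 0.
pose p k := T (k, S k).
have SE m : \sum_(k < m) p k = S m.
  by elim: m => [|m IH]; rewrite ?big_ord0 // big_ord_recr /= IH.
have [|h [dh hh]] := @entire_series R p.
  move=> rho r0.
  (* Beyond [K] the radius [k] exceeds [rho]; below it, finitely many terms. *)
  pose K := (Num.truncn rho).+1.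
  exists (1 + \sum_(k < K) coef_norm (p k) rho * 2 ^+ k) => k.
  have s0 (A : pred 'I_K) : 0 <= \sum_(k < K | A k) coef_norm (p k) rho * 2 ^+ k.
    by apply: sumr_ge0 => i _; rewrite mulr_ge0 ?exprn_ge0 // coef_norm_ge0 // ltW.
  rewrite ler_pdivlMr ?exprn_gt0 //.
  have [kK|Kk] := ltnP k K.
    by rewrite (bigD1 (Ordinal kK)) //= addrCA lerDl addr_ge0.
  rewrite -[leLHS]addr0 lerD //.
  have [+ _ _] := hT (k, S k); rewrite /= ler_pdivlMr ?exprn_gt0 //.
  apply: le_trans; rewrite ler_wpM2r ?exprn_ge0 // ler_coef_norm // ?ltW //.
  by rewrite (lt_le_trans (truncnS_gt _)) // ler_nat.
exists h; split=> // k; apply/eqP; rewrite -subr_eq0; apply/eqP/modulus_eq0.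
apply: le_anti; rewrite modulus_ge0 andbT.
have [M hM] := hh (b k).
have vS m : (S (k.+1 + m)%N).[b k] = v k.
  elim: m => [|m IH].
    by rewrite addn0 /=; have [_ _] := hT (k, S k).
  rewrite addnS /= hornerD IH; have [_ h0 _] := hT ((k.+1 + m)%N, S (k.+1 + m)%N).
  by rewrite h0 ?addr0 //= ltnS leq_addr.
have M0 : 0 <= M.
  by have := le_trans (modulus_ge0 _) (hM 0); rewrite expr0 divr1.
apply: (@le_of_geometric_error _ _ _ M) => m; rewrite add0r.
have := hM (k.+1 + m)%N; rewrite -horner_sum SE vS => /le_trans; apply.
rewrite ler_wpM2l // lef_pV2 ?posrE ?exprn_gt0 //.
by rewrite ler_weXn2l ?leq_addl // ler1n.
Qed.

(** The enumeration 0, -1, 1, -2, 2, ... of the integers. *)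
Definition int_of_nat_enum (k : nat) : int :=
  if odd k then Negz k./2 else Posz k./2.

Definition nat_of_int_enum (m : int) : nat :=
  match m with Posz k => k.*2 | Negz k => k.*2.+1 end.

Lemma int_of_nat_enumK : cancel int_of_nat_enum nat_of_int_enum.
Proof.
move=> k; rewrite /int_of_nat_enum; case: ifP => ko /=.
  by rewrite -[RHS]odd_double_half ko.
by rewrite -[RHS]odd_double_half ko.
Qed.

Lemma nat_of_int_enumK : cancel nat_of_int_enum int_of_nat_enum.
Proof.
case=> k; rewrite /int_of_nat_enum /=; first by rewrite odd_double doubleK.
by rewrite odd_double /= uphalf_double.
Qed.

Lemma entire_interpolation_int (v : int -> Cplx R) :
  exists h : Cplx R -> Cplx R,
    (forall z, differentiable h z) /\ forall m : int, h m%:~R = v m.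
Proof.
(* The affine change of variable [4 z + 2] moves the [k]-th integer out of the
   disc of radius [k], as [entire_interpolation] demands of its nodes. *)
pose b k : Cplx R := 4 * (int_of_nat_enum k)%:~R + 2.
have bE k : b k = (4 * (int_of_nat_enum k)%:~R + 2 : R)%:C%C.
  by rewrite rmorphD rmorphM /= rmorph_int !rmorph_nat.
have [||h [dh hh]] := @entire_interpolation b (v \o int_of_nat_enum).
- move=> j k /addIr /mulfI jk; apply: (can_inj int_of_nat_enumK).
  by apply: (@intr_inj (Cplx R)); apply: jk; rewrite pnatr_eq0.
- move=> k; rewrite bE modulus_real /int_of_nat_enum.
  rewrite -[X in X%:R]odd_double_half natrD -mul2n natrM.
  have := ler0n R k./2.
  case: (odd k) => /=; last by move=> ?; rewrite ger0_norm -?pmulrn; lra.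
  by rewrite NegzE mulrNz -pmulrn -natr1 => ?; rewrite ler0_norm; lra.
exists (fun z => h (4 * z + 2)); split=> [z|m].
  change (differentiable (h \o (fun z : Cplx R => 4 * z + 2)) z).
  apply: differentiable_comp; last exact: dh.
  apply: differentiableD; last exact: differentiable_cst.
  exact: (@differentiableZ _ _ _ id).
by have := hh (nat_of_int_enum m); rewrite /b /= nat_of_int_enumK.
Qed.

End Interpolation.

(** * Shears *)

Section Shears.
Variables (R : realType) (n : nat).
Local Notation C := (Cplx R).
Local Notation Cn := 'rV[Cplx R]_n.

Lemma automorphism_comp (phi psi : Cn -> Cn) :
  automorphism phi -> automorphism psi -> automorphism (psi \o phi).
Proof.
move=> [phi' [k1 k2 d1 d2]] [psi' [k3 k4 d3 d4]]; exists (phi' \o psi').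
split; [exact: can_comp| exact: can_comp| |].
- by move=> z; apply: differentiable_comp.
- by move=> z; apply: differentiable_comp.
Qed.

Definition linear_form (l : 'I_n -> C) (z : Cn) : C := \sum_j l j * z 0 j.

Definition shear (l : 'I_n -> C) (h : 'I_n -> C -> C) (z : Cn) : Cn :=
  \row_j (z 0 j + h j (linear_form l z)).

(** A shear moves points along the level sets of [linear_form l], hence the form
    can be read off after the shear and the shear undone. *)
Lemma linear_form_shear (l : 'I_n -> C) (h : 'I_n -> C -> C) z :
  (forall c, \sum_j l j * h j c = 0) ->
  linear_form l (shear l h z) = linear_form l z.
Proof.
move=> lh; rewrite {1}/linear_form.
under eq_bigr => j _ do rewrite mxE mulrDr.
by rewrite big_split /= lh addr0.
Qed.

Lemma linear_formB l z w :
  linear_form l (z - w) = linear_form l z - linear_form l w.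
Proof.
rewrite /linear_form -sumrB.
by apply: eq_bigr => j _; rewrite !mxE mulrBr.
Qed.

Lemma differentiable_linear_form l z : differentiable (linear_form l) z.
Proof.
have -> : linear_form l = \sum_j (fun z : Cn => l j *: (z 0 j : C^o)).
  by apply/funext => w; rewrite fct_sumE.
apply: differentiable_sum => j.
exact: (differentiableZ _ (differentiable_coord _ _ _)).
Qed.

Lemma holomorphic_shear (l : 'I_n -> C) (h : 'I_n -> C -> C) :
  (forall j c, differentiable (h j) c) -> holomorphic (shear l h).
Proof.
move=> dh z.
have -> : shear l h =
    id + \sum_j (fun z : Cn => h j (linear_form l z) *: (delta_mx 0 j : Cn)).
  apply/funext => w; rewrite fctE fct_sumE; apply/rowP => j.
  rewrite !mxE summxE (bigD1 j) //= !mxE !eqxx mulr1 big1 ?addr0 // => i ij.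
  by rewrite !mxE eqxx /= eq_sym (negPf ij) mulr0.
apply: differentiableD; first by [].
apply: differentiable_sum => j; apply: differentiableZl.
exact: (@differentiable_comp _ _ _ _ (linear_form l) (h j) z
  (differentiable_linear_form l z) (dh j _)).
Qed.

Lemma automorphism_shear (l : 'I_n -> C) (h : 'I_n -> C -> C) :
  (forall j c, differentiable (h j) c) -> (forall c, \sum_j l j * h j c = 0) ->
  automorphism (shear l h).
Proof.
move=> dh lh; pose h' j c := - h j c.
have lh' c : \sum_j l j * h' j c = 0.
  by under eq_bigr => j _ do rewrite /h' mulrN; rewrite sumrN lh oppr0.
exists (shear l h'); split.
- by move=> z; apply/rowP => j; rewrite mxE linear_form_shear // mxE addrK.
- by move=> z; apply/rowP => j; rewrite mxE linear_form_shear // mxE subrK.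
- exact: holomorphic_shear.
- apply: holomorphic_shear => j c; exact: differentiableN.
Qed.

Lemma linear_form_coord (i : 'I_n) z :
  linear_form (fun j => (j == i)%:R) z = z 0 i.
Proof.
rewrite /linear_form (bigD1 i) //= eqxx mul1r big1 ?addr0 // => j /negPf ->.
by rewrite mul0r.
Qed.

Lemma automorphism_coord_shear (i : 'I_n) (h : 'I_n -> C -> C) :
  (forall j c, differentiable (h j) c) -> (forall c, h i c = 0) ->
  automorphism (fun z : Cn => \row_j (z 0 j + h j (z 0 i))).
Proof.
move=> dh hi.
have -> : (fun z : Cn => \row_j (z 0 j + h j (z 0 i))) =
    shear (fun j => (j == i)%:R) h.
  by apply/funext => z; apply/rowP => j; rewrite !mxE linear_form_coord.
apply: automorphism_shear => // c.
rewrite (bigD1 i) //= hi mulr0 big1 ?addr0 // => j /negPf ->.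
by rewrite mul0r.
Qed.

End Shears.

(** * Generic linear forms *)

Section GenericForm.
Variables (R : realType) (n : nat).
Local Notation C := (Cplx R).
Local Notation Cn := 'rV[Cplx R]_n.
Implicit Types z : Cn.

Definition l1norm (z : Cn) : R := \sum_j modulus (z 0 j).

Lemma l1norm_ge0 z : 0 <= l1norm z.
Proof. by apply: sumr_ge0 => j _; exact: modulus_ge0. Qed.

Lemma modulus_le_l1norm z j : modulus (z 0 j) <= l1norm z.
Proof.
rewrite /l1norm (bigD1 j) //= lerDl; apply: sumr_ge0 => i _.
exact: modulus_ge0.
Qed.

Lemma l1norm_le_coord (i0 : 'I_n) z : exists j, l1norm z <= n%:R * modulus (z 0 j).
Proof.
have [j _ hj] := @Order.TotalTheory.arg_maxP _ _ _ i0 predT (fun j => modulus (z 0 j)) isT.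
exists j; apply: le_trans (ler_sum _ (fun i _ => hj i isT)) _.
by rewrite sumr_const card_ord mulr_natl.
Qed.

Let real_form (c : 'I_n -> R) := linear_form (fun j => (c j)%:C%C : C).

Lemma real_formB c c' z (e : R) : (forall j, `|c j - c' j| <= e) ->
  modulus (real_form c z - real_form c' z) <= e * l1norm z.
Proof.
move=> ce; rewrite /real_form /linear_form -sumrB mulr_sumr.
apply: le_trans (modulus_sum _ _ _) _; apply: ler_sum => j _.
by rewrite -mulrBl -rmorphB modulusM modulus_real ler_wpM2r ?modulus_ge0.
Qed.

Lemma far_endpoint (z w d : C) (r : R) :
  modulus d >= 2 * r -> w = z + d -> r <= modulus z \/ r <= modulus w.
Proof.
move=> dr wE; have := modulusD (- z) w; rewrite modulusN wE addKr => h.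
by have [|?] := leP r (modulus z); [left|right; lra].
Qed.

(** The coefficients are the limit of a sequence whose [m]-th step treats [y m]
    and has length at most [q ^+ m]. Either the current form, or the one obtained
    by adding [q ^+ m] to the coefficient of a largest coordinate of [y m], is
    large at [y m]. The later steps together undo at most half of this, as [q] is
    small. The lower bounds thus depend on [m] alone, which is what
    allows the points of a tame set to be pushed out after the bounds are known. *)
Lemma exists_generic_real_form (i0 : 'I_n) (y : nat -> Cn) :
  let q : R := (8 * n%:R)^-1 in
  exists c : 'I_n -> R, (forall j, 1 <= c j <= 5) /\
    forall m, q ^+ m / (4 * n%:R) * l1norm (y m) <= modulus (real_form c (y m)).
Proof.
move=> q.
have n1 : 1 <= n%:R :> R by rewrite ler1n (leq_trans _ (ltn_ord i0)).
have n0 : 0 < n%:R :> R by lra.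
have q0 : 0 < q by rewrite invr_gt0 mulr_gt0.
have qn : q * n%:R = 1 / 8 by rewrite /q; field; rewrite gt_eqF.
have q8 : q <= 1 / 8 by rewrite -qn ler_peMr // ltW.
have /choice[T hT] (mc : nat * ('I_n -> R)) : exists c' : 'I_n -> R,
    (forall j, `|c' j - mc.2 j| <= q ^+ mc.1) /\
    q ^+ mc.1 / (2 * n%:R) * l1norm (y mc.1) <= modulus (real_form c' (y mc.1)).
  case: mc => m c /=.
  have qm : 0 < q ^+ m by rewrite exprn_gt0.
  have [j hj] := l1norm_le_coord i0 (y m).
  pose c' i := c i + q ^+ m * (i == j)%:R.
  have c'E : real_form c' (y m) = real_form c (y m) + (q ^+ m)%:C%C * y m 0 j.
    rewrite /real_form /linear_form /c'.
    under eq_bigr => i _ do rewrite rmorphD mulrDl.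
    rewrite big_split /=; congr (_ + _).
    rewrite (bigD1 j) //= eqxx mulr1 big1 ?addr0 // => i /negPf ->.
    by rewrite mulr0 rmorph0 mul0r.
  have [||h|h] := @far_endpoint (real_form c (y m)) (real_form c' (y m))
    ((q ^+ m)%:C%C * y m 0 j) (q ^+ m / (2 * n%:R) * l1norm (y m)).
  - rewrite modulusM modulus_real (ger0_norm (ltW qm)).
    have -> : 2 * (q ^+ m / (2 * n%:R) * l1norm (y m)) = q ^+ m * (l1norm (y m) / n%:R).
      by field; rewrite gt_eqF.
    by rewrite ler_wpM2l ?(ltW qm) // ler_pdivrMr // mulrC.
  - exact: c'E.
  - by exists c; split=> // i; rewrite subrr normr0 ltW.
  - exists c'; split=> // i; rewrite /c' addrC addKr.
    by case: eqP => _; rewrite ?mulr1 ?mulr0 ?normr0 ?(ger0_norm (ltW qm)) // ltW.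
(* The start value 3 keeps the coefficients between 1 and 5. *)
pose c := fix c m : 'I_n -> R := if m is m'.+1 then T (m', c m') else fun=> 3.
pose e m : R := q ^+ m / (1 - q).
have q1 : 0 < 1 - q by lra.
have /choice[t ht] j : exists t : R, forall m, `|t - c m j| <= e m.
  apply: (@squeeze_limit _ (fun m => c m j) e) => m.
    by rewrite divr_ge0 ?exprn_ge0 ?ltW.
  have [h _] := hT (m, c m); apply: le_trans (h j) _.
  by rewrite /e exprS le_eqVlt; apply/orP; left; apply/eqP; field; rewrite gt_eqF.
have e2 m : e m <= 2 * q ^+ m.
  by rewrite /e ler_pdivrMr // mulrAC ler_peMl ?exprn_ge0 ?ltW //; lra.
exists t; split=> [j|m].
  by have := ht j 0; have := e2 0; rewrite expr0 /= ler_norml; lra.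
have [_ /= h1] := hT (m, c m).
have h2 : modulus (real_form (c m.+1) (y m) - real_form t (y m))
    <= 2 * q ^+ m.+1 * l1norm (y m).
  by apply: real_formB => j; rewrite distrC; apply: le_trans (ht j m.+1) (e2 _).
have := modulusD (real_form (c m.+1) (y m) - real_form t (y m)) (real_form t (y m)).
rewrite subrK /= => h3.
have -> : q ^+ m / (4 * n%:R) * l1norm (y m) =
    q ^+ m / (2 * n%:R) * l1norm (y m) - 2 * q ^+ m.+1 * l1norm (y m).
  by rewrite exprS {3}/q; field; rewrite gt_eqF.
by move: h1 h2 h3 => /=; lra.
Qed.

(** The rank [pickle i] turns a countable family into a sequence; a bound that
    depends on this rank is still independent of the vectors. The coefficient
    [l i0 = 1] is what lets a shear turn the form into the coordinate [i0]; the
    price is a factor 5, the upper bound on the coefficients before scaling. *)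
Lemma exists_generic_form (i0 : 'I_n) (I : countType) :
  exists2 eps : I -> R, (forall i, 0 < eps i) &
    forall y : I -> Cn, exists2 l : 'I_n -> C, l i0 = 1 &
      forall i, eps i * l1norm (y i) <= modulus (linear_form l (y i)).
Proof.
have n0 : 0 < n%:R :> R by rewrite ltr0n (leq_trans _ (ltn_ord i0)).
pose q : R := (8 * n%:R)^-1.
have q0 : 0 < q by rewrite invr_gt0 mulr_gt0.
exists (fun i => q ^+ pickle i / (4 * n%:R) / 5) => [i|y].
  by rewrite !divr_gt0 ?mulr_gt0 ?exprn_gt0.
have [c [c15 hc]] := exists_generic_real_form i0 (fun m => oapp y 0 (unpickle m)).
have c0 : 0 < c i0 by have := c15 i0; lra.
exists (fun j => (c j / c i0)%:C%C) => [|i]; first by rewrite divff ?gt_eqF.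
have -> : linear_form (fun j => (c j / c i0)%:C%C : C) (y i)
    = ((c i0)^-1)%:C%C * real_form c (y i).
  rewrite /real_form /linear_form mulr_sumr; apply: eq_bigr => j _.
  by rewrite rmorphM /=; ring.
have := hc (pickle i); rewrite pickleK /= => h.
rewrite modulusM modulus_real ger0_norm ?invr_ge0 ?(ltW c0) // [leRHS]mulrC ler_pdivlMr //.
apply: le_trans h; rewrite -/q.
set a := q ^+ _ / _; have a0 : 0 <= a * l1norm (y i).
  by rewrite mulr_ge0 ?l1norm_ge0 // divr_ge0 ?exprn_ge0 ?mulr_ge0 ?ltW.
have : c i0 * (a * l1norm (y i)) <= 5 * (a * l1norm (y i)).
  by rewrite ler_wpM2r //; have := c15 i0; lra.
lra.
Qed.

End GenericForm.

(** * Exhaustion and discreteness *)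

Section Exhaustion.
Variable R : realType.

Lemma continuous_modulus : continuous (@modulus R).
Proof.
move=> z; apply: (@cvgrPdist_le _ _ _ (nbhs z) _ _ _).2 => e e0.
apply/nbhs_ballP; exists (e%:C)%C => [|w]; first by rewrite /= ltcR.
rewrite -ball_normE /= normE ltcR => /ltW; apply: le_trans.
have := modulusD (z - w) w; have := modulusD (w - z) z.
by rewrite !subrK (modulusB w) ler_norml; lra.
Qed.

Lemma compact_disc (c : R) : compact [set z : Cplx R | modulus z <= c].
Proof.
pose f (p : R * R) : Cplx R := (p.1 +i* p.2)%C.
have cf : continuous f.
  move=> p; apply: (@cvgrPdist_le _ _ _ (nbhs p) _ _ _).2 => e e0.
  have er : (complex.Re e)%:C%C = e by rewrite RRe_real // gtr0_real.
  have e0' : 0 < complex.Re e by rewrite -ltcR er.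
  apply/nbhs_ballP; exists (complex.Re e / 2) => [|q [/= /ltW h1 /ltW h2]].
    by rewrite /= divr_gt0.
  rewrite -er normE lecR.
  have -> : f p - f q = ((p.1 - q.1) +i* (p.2 - q.2))%C by [].
  by apply: le_trans (modulus_le_ReIm _) _ => /=; lra.
have K : compact (f @` (`[- c, c] `*` `[- c, c])).
  apply: continuous_compact; first exact: continuous_subspaceT.
  by apply: compact_setX; exact: segment_compact.
apply: subclosed_compact K _.
  rewrite (_ : [set z | _] = (@modulus R) @^-1` [set x | x <= c]) //.
  by apply: (continuous_closedP _).1; [exact: continuous_modulus|exact: closed_le].
move=> z /= zc; exists (complex.Re z, complex.Im z); last by case: (z).
have := le_trans (Re_le_modulus z) zc; have := le_trans (Im_le_modulus z) zc.
by rewrite !ler_norml /= !in_itv /=.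
Qed.

Variable n : nat.
Local Notation Cn := 'rV[Cplx R]_n.

Lemma continuous_l1norm : continuous (@l1norm R n).
Proof.
apply: continuous_big => [|j _ z]; first exact: add_continuous.
apply: (@continuous_comp _ _ _ (fun z : Cn => z 0 j) (@modulus R)).
  exact: coord_continuous.
exact: continuous_modulus.
Qed.

Lemma exhaustion_l1norm : exhaustion_function (@l1norm R n).
Proof.
split=> [z||c]; [exact: l1norm_ge0|exact: continuous_l1norm|].
have K : compact [set z : Cn | forall j, [set w | modulus w <= c] (z ord0 j)].
  by apply: (@rV_compact (Cplx R) n (fun=> [set w | modulus w <= c])) => j; exact: compact_disc.
apply: subclosed_compact K _ => [|z /= zc j].
  rewrite (_ : [set z | _] = (@l1norm R n) @^-1` [set x | x <= c]) //.
  by apply: (continuous_closedP _).1; [exact: continuous_l1norm|exact: closed_le].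
exact: le_trans (modulus_le_l1norm _ _) zc.
Qed.

(** Each point has a neighbourhood that meets [D] at most in this point, and
    finitely many of these cover [K]. *)
Lemma discrete_compact_finite (D K : set Cn) :
  discrete_subset D -> compact K -> finite_set (D `&` K).
Proof.
move=> discD; rewrite compact_cover => cK.
have /choice[U hU] (z : Cn) : exists U : set Cn,
    [/\ open U, U z & D `&` U `<=` [set z]].
  have : ~ limit_point D z by rewrite discD.
  rewrite not_limit_pointE => -[X]; rewrite nbhsE => -[U [oU Uz] UX] DX.
  by exists U; split=> // w [Dw /UX Xw]; exact: DX.
have [||F _ KF] := cK _ setT U.
- by move=> z _; have [] := hU z.
- by move=> z _; exists z => //; have [] := hU z.
apply: (sub_finite_set _ (finite_fset F)) => w [Dw /KF[z zF Uzw]].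
by have [_ _ /(_ w (conj Dw Uzw)) ->] := hU z.
Qed.

Lemma discrete_countable (D : set Cn) : discrete_subset D -> countable D.
Proof.
move=> discD.
have -> : D = \bigcup_(k in [set: nat]) (D `&` [set z | l1norm z <= k%:R]).
  apply/seteqP; split=> [z Dz|z [k _ []//]].
  exists (Num.truncn (l1norm z)).+1 => //; split=> //=.
  exact/ltW/truncnS_gt.
apply: bigcup_countable => // k _; apply: finite_set_countable.
by apply: discrete_compact_finite => //; case: exhaustion_l1norm.
Qed.

Lemma compact_avoids_line (K : set Cn) (p : Cn) (j : 'I_n) :
  compact K -> exists v : Cplx R, ~ K (p + v *: delta_mx 0 j).
Proof.
move=> cK; apply: contrapT => /forallNP hK.
have [||z _ hz] := @compact_EVT_max _ R (@l1norm R n) K _ cK.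
- by exists (p + 0 *: delta_mx 0 j); apply: contrapT; exact: hK.
- exact/continuous_subspaceT/continuous_l1norm.
pose v : Cplx R := (l1norm z + 1)%:C%C - p 0 j.
have /hz : p + v *: delta_mx 0 j \in K by rewrite inE; apply: contrapT; exact: hK.
apply/negP; rewrite -ltNge.
apply: lt_le_trans (modulus_le_l1norm _ j).
rewrite !mxE !eqxx mulr1 addrC subrK modulus_real.
by rewrite ger0_norm ?addr_ge0 ?l1norm_ge0 // ltrDl.
Qed.

End Exhaustion.

(** * The two directions *)

Section Equivalence.
Variables (R : realType) (n : nat).
Local Notation C := (Cplx R).
Local Notation Cn := 'rV[Cplx R]_n.

Definition axis_integer (m : int) : Cn :=
  \row_(j < n) (if j == 0%N :> nat then m%:~R else 0).

Lemma axis_integerE (i0 : 'I_n) (m : int) (j : 'I_n) : i0 = 0%N :> nat ->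
  axis_integer m 0 j = if j == i0 then m%:~R else 0.
Proof. by move=> i0E; rewrite mxE -[in LHS]i0E. Qed.

(** Shears in the direction of the second axis, driven by the first coordinate,
    move the integers of the first axis along disjoint complex lines. No line
    lies in a compact sublevel set, so on each of them some point is high enough
    for [rho]; an entire function interpolates these points. *)
Lemma tame_of_rosay_rudin_tame (i0 i1 : 'I_n) (D : set Cn) :
  i0 = 0%N :> nat -> i1 != i0 ->
  discrete_subset D -> rosay_rudin_tame D -> tame D.
Proof.
move=> i0E i01 discD [phi autphi phiD]; split=> //.
  move=> finD; apply: infinite_nat.
  have -> : [set: nat] = (axis_integer \o Posz) @^-1` (phi @` D).
    apply/seteqP; split=> // k _.
    by have : (phi @` D) (axis_integer k) by rewrite phiD; exists k.
  apply: finite_preimage; last exact: finite_image.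
  move=> j k _ _ /rowP /(_ i0); rewrite !(axis_integerE _ _ i0E) eqxx -!pmulrn => /eqP.
  by rewrite eqr_nat => /eqP.
move=> rho zeta [_ _ rho_compact] _.
have [psi [phiK psiK _ _]] := autphi.
have /choice[v hv] (m : int) : exists v : C,
    ~ rho (axis_integer m + v *: delta_mx 0 i1) <= zeta (psi (axis_integer m)).
  exact: (compact_avoids_line (axis_integer m) i1 (rho_compact (zeta (psi (axis_integer m))))).
have [h [dh hE]] := entire_interpolation_int v.
pose H j : C -> C := if j == i1 then h else fun=> 0.
exists ((fun z : Cn => \row_j (z 0 j + H j (z 0 i0))) \o phi).
  apply: automorphism_comp => //; apply: automorphism_coord_shear => [j c|c].
    by rewrite /H; case: ifP => _ //; exact: differentiable_cst.
  by rewrite /H eq_sym (negPf i01).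
move=> x Dx /=; have : (phi @` D) (phi x) by exists x.
rewrite phiD => -[m phix].
have mE : phi x = axis_integer m by [].
have := hv m; rewrite -mE phiK => /negP; rewrite -ltNge => /ltW.
congr (_ <= rho _); apply/rowP => j; rewrite mxE [RHS]mxE mE; congr (_ + _).
rewrite /H !mxE eqxx /= i0E eqxx; case: eqP => _; last by rewrite mulr0.
by rewrite hE mulr1.
Qed.

(** Four shears: the form [l] becomes the first coordinate; as it takes distinct
    values that tend to infinity, an entire function of it can replace the second
    coordinate by an integer and the others by 0; then an entire function of
    the second coordinate sets the first one to the same integer; finally the
    second coordinate is cleared. *)
Lemma straighten_escaping_sequence (i0 i1 : 'I_n) (w : nat -> Cn) (l : 'I_n -> C) :
  i0 = 0%N :> nat -> i1 != i0 ->
  l i0 = 1 -> injective (fun k => linear_form l (w k)) ->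
  (forall k, k%:R < modulus (linear_form l (w k))) ->
  exists2 Phi : Cn -> Cn, automorphism Phi &
    forall k, Phi (w k) = axis_integer (int_of_nat_enum k).
Proof.
move=> i0E i01 l0 b_inj b_gt; set b := fun k => _ in b_inj.
pose l' j : C := if j == i0 then 0 else l j.
pose hA j : C -> C := if j == i0 then id else fun=> 0.
(* The first coordinate becomes [linear_form l]. *)
pose A := shear l' hA.
have autA : automorphism A.
  apply: automorphism_shear => [j c|c].
    by rewrite /hA; case: ifP => _ //; exact: differentiable_cst.
  by rewrite big1 // => j _; rewrite /l' /hA; case: ifP; rewrite ?mul0r ?mulr0.
have A0 k : A (w k) 0 i0 = b k.
  rewrite mxE /hA eqxx /b /linear_form [RHS](bigD1 i0) //= l0 mul1r; congr (_ + _).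
  rewrite (bigD1 i0) //= /l' eqxx mul0r add0r.
  by apply: eq_bigr => j /negPf ->.
have /choice[h hh] (j : 'I_n) := entire_interpolation
  (fun k => (if j == i1 then (int_of_nat_enum k)%:~R else 0) - A (w k) 0 j) b_inj b_gt.
pose hS j : C -> C := if j == i0 then fun=> 0 else h j.
pose S2 := fun z : Cn => \row_j (z 0 j + hS j (z 0 i0)).
have [g [dg gE]] := entire_interpolation_int
  (fun m : int => m%:~R - b (nat_of_int_enum m)).
pose hG j : C -> C := if j == i0 then g else fun=> 0.
pose S3 := fun z : Cn => \row_j (z 0 j + hG j (z 0 i1)).
pose hN j : C -> C := if j == i1 then -%R else fun=> 0.
pose S4 := fun z : Cn => \row_j (z 0 j + hN j (z 0 i0)).
exists (S4 \o (S3 \o (S2 \o A))).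
  apply: automorphism_comp; first apply: automorphism_comp; first apply: automorphism_comp => //.
  - apply: automorphism_coord_shear => [j c|c]; last by rewrite /hS eqxx.
    by rewrite /hS; case: ifP => _; [exact: differentiable_cst | exact: (hh j).1].
  - apply: automorphism_coord_shear => [j c|c]; last by rewrite /hG (negPf i01).
    by rewrite /hG; case: ifP => _; [exact: dg | exact: differentiable_cst].
  - apply: automorphism_coord_shear => [j c|c]; last by rewrite /hN eq_sym (negPf i01).
    rewrite /hN; case: ifP => _; last exact: differentiable_cst.
    exact: (@differentiableN _ _ _ id).
move=> k; set m := int_of_nat_enum k.
have S2E j : S2 (A (w k)) 0 j = if j == i0 then b k else if j == i1 then m%:~R else 0.
  rewrite mxE A0 /hS; case: eqP => [->|_]; first by rewrite A0 addr0.
  by rewrite (hh j).2 addrC subrK.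
have S3E j : S3 (S2 (A (w k))) 0 j = if j == i0 then m%:~R else if j == i1 then m%:~R else 0.
  rewrite mxE !S2E eqxx (negPf i01) /hG; case: eqP => _; last by rewrite addr0.
  by rewrite gE /m int_of_nat_enumK addrC subrK.
apply/rowP => j; rewrite [LHS]mxE !S3E eqxx (axis_integerE _ _ i0E) /hN.
have [->|_] := eqVneq j i1; first by rewrite (negPf i01) subrr.
by rewrite addr0.
Qed.

(** The lower bounds [eps] of [exists_generic_form] do not depend on the vectors,
    so tameness can push the [k]-th point to norm at least [(k + 1) / eps k]
    before the form is chosen. The generic form then exceeds [k] there. Applied
    to the differences of the points as well, it also separates them. *)
Lemma rosay_rudin_tame_of_tame (i0 i1 : 'I_n) (D : set Cn) :
  i0 = 0%N :> nat -> i1 != i0 -> tame D -> rosay_rudin_tame D.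
Proof.
move=> i0E i01 [infD discD tameD].
have /card_set_bijP[index [_ index_inj index_surj]] : (D #= [set: nat])%card.
  by apply: eq_card_nat => //; exact: discrete_countable.
have /choice[e he] (k : nat) : exists x, D x /\ index x = k.
  by have [x Dx <-] := index_surj k I; exists x.
have eD k : D (e k) := (he k).1.
have indexK k : index (e k) = k := (he k).2.
have eK x : D x -> e (index x) = x.
  by move=> Dx; apply: index_inj; rewrite ?inE // indexK.
have [eps eps0 heps] := exists_generic_form R i0 (nat + nat * nat)%type.
have [||phi autphi phi_large] := tameD (@l1norm R n)
    (fun x => (index x).+1%:R / eps (inl (index x))).
- exact: exhaustion_l1norm.
- by move=> x _; rewrite divr_ge0 // ltW.
pose w k := phi (e k).
have w_inj : injective w.
  have [psi [phiK _ _ _]] := autphi.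
  exact: inj_comp (can_inj phiK) (can_inj indexK).
have [l l0 hl] := heps (fun s => match s with inl k => w k | inr ij => w ij.1 - w ij.2 end).
have [||Phi autPhi PhiE] := straighten_escaping_sequence (w := w) i0E i01 l0.
- move=> i j /= bij; apply: contrapT => ij.
  have := hl (inr (i, j)).
  have -> : linear_form l (w i - w j) = 0.
    by rewrite linear_formB bij subrr.
  rewrite modulus0 pmulr_rle0 //= => wij; apply/ij/w_inj/eqP.
  rewrite -subr_eq0; apply/eqP/rowP => s; rewrite [RHS]mxE; apply: modulus_eq0.
  apply: le_anti; rewrite modulus_ge0 andbT.
  by apply: le_trans wij; exact: modulus_le_l1norm.
- move=> k; have := phi_large (e k) (eD k); rewrite indexK ler_pdivrMr //.
  have := hl (inl k); rewrite /= mulrC => h1 h2.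
  by apply: lt_le_trans (le_trans h2 h1); rewrite ltr_nat.
exists (Phi \o phi); first exact: automorphism_comp.
apply/seteqP; split=> [_ [x Dx <-]|z [m zE]].
  by exists (int_of_nat_enum (index x)); rewrite -[in LHS](eK _ Dx) /= PhiE.
exists (e (nat_of_int_enum m)); first exact: eD.
by rewrite /= PhiE nat_of_int_enumK zE.
Qed.

End Equivalence.

Theorem proposition4p7 (R : realType) (n : nat) (n_ge2 : (2 <= n)%N)
    (D : set 'rV[Cplx R]_n) (discD : discrete_subset D) :
  tame D <-> rosay_rudin_tame D.
Proof.
pose i0 := Ordinal (ltnW n_ge2); pose i1 := Ordinal n_ge2.
split; first exact: (@rosay_rudin_tame_of_tame R n i0 i1).
by move=> RR; apply: (@tame_of_rosay_rudin_tame R n i0 i1).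
Qed.
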